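(* Let $\mathsf{E}$ be a logic. Then $\mathsf{U}_{[1]}(\mathsf{E})$ and $\mathsf{E}$ are isomorphic orthocomplemented complete lattices via the map $\hat{\varphi}_{[1]}:\mathsf{E}\to\mathsf{U}_{[1]}(\mathsf{E})$, $a\mapsto[a]$.
   Context: A logic is a complete orthocomplemented (not necessarily distributive) lattice $(\mathsf{E},\subseteq,\cup,\cap,{}^c,\mathbf{0},\mathbf{1})$. Everything below is for $\kappa=[1]=\{1\}$, where $\mathsf{E}^{[1]}=\mathsf{E}$. A term is a function $i\in I\mapsto a^i\in\mathsf{E}$, written $\bigsqcup_{i\in I}a^i$, with $|I|\leq2^{|\mathsf{E}|}$. Put $\bigsqcup_{i\in I}a^i\backsim\bigsqcup_{j\in J}b^j$ iff for every $i\in I$ there is $j\in J$ with $a^i\subseteq b^j$ (if $J=\emptyset$: $a^i=\mathbf{0}$), and for every $j\in J$ there is $i\in I$ with $b^j\subseteq a^i$ (if $I=\emptyset$: $b^j=\mathbf{0}$). This is an equivalence relation, and $\mathsf{D}_{[1]}(\mathsf{E})$ is the set of its classes. For families with larger index sets, $[\bigsqcup_{i\in I}a^i]$ denotes the class of the terms equivalent (same condition) to the family. Every class has a representative with $I\neq\emptyset$, and such representatives are always used. Order: $[\bigsqcup_{i\in I}a^i]\leq[\bigsqcup_{j\in J}b^j]$ iff $[\bigsqcup_{i\in I}a^i\sqcup\bigsqcup_{j\in J}b^j]=[\bigsqcup_{j\in J}b^j]$ (here $\sqcup$ is the family on the disjoint union of $I$ and $J$). With it $\mathsf{D}_{[1]}(\mathsf{E})$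 is a complete lattice with suprema $\bigvee$, infima $\bigwedge$, bottom $[\mathbf{0}]$ and top $[\mathbf{1}]$; $a\mapsto[a]$ is an order embedding of $\mathsf{E}$, and $[\bigsqcup_{i\in I}a^i]=\bigvee_{i\in I}[a^i]$. The function $*:\mathsf{D}_{[1]}(\mathsf{E})\to\mathsf{D}_{[1]}(\mathsf{E})$ is given (for $\kappa=[1]$ there is a single function $f:I\to\kappa$) by $[\bigsqcup_{i\in I}a^i]^*=\big[\bigcap_{i\in I}(a^i)^c\big]$ for $I\neq\emptyset$. $\mathsf{U}_{[1]}(\mathsf{E})=\{\mathbb{A}\in\mathsf{D}_{[1]}(\mathsf{E}):\mathbb{A}^{**}=\mathbb{A}\}$ with the inherited order; it contains every $[a]$, $a\in\mathsf{E}$, and is an orthocomplemented complete lattice with the same infima, bottom and top as $\mathsf{D}_{[1]}(\mathsf{E})$, supremum $\coprod S=(\bigvee S)^{**}$ and orthocomplementation $*$. *)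

(* Defs.v *)
From HB Require Import structures.
From mathcomp Require Import all_boot all_order.
From mathcomp Require Import boolp classical_sets.

Set Implicit Arguments.
Unset Strict Implicit.
Unset Printing Implicit Defensive.

Import Order.TTheory.
Local Open Scope classical_set_scope.
Local Open Scope order_scope.

HB.mixin Record isCompletePOrder d T of Order.POrder d T := {
  bigjoin : set T -> T;
  bigmeet : set T -> T;
  bigjoin_supremum : forall S : set T, supremums S (bigjoin S);
  bigmeet_infimum : forall S : set T, infimums S (bigmeet S);
}.

#[short(type="completeLatticeType")]
HB.structure Definition CompleteLattice d :=
  { T of Order.TBLattice d T & isCompletePOrder d T }.

HB.mixin Record isOrthocomplemented d T of Order.TBLattice d T := {
  ocompl : T -> T;
  ocomplK : involutive ocompl;
  ocompl_anti : forall x y : T, x <= y -> ocompl y <= ocompl x;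
  meetx_ocompl : forall x : T, Order.meet x (ocompl x) = \bot;
  joinx_ocompl : forall x : T, Order.join x (ocompl x) = \top;
}.

(* Logics; distributivity is not assumed, and \bot = \top is allowed. *)
#[short(type="logicType")]
HB.structure Definition Logic d :=
  { T of CompleteLattice d T & isOrthocomplemented d T }.

Record logic_isomorphism d d' (L : logicType d) (M : logicType d')
    (f : L -> M) : Prop := LogicIsomorphism {
  logic_iso_bij : bijective f;
  logic_iso_le : forall x y, (f x <= f y) = (x <= y);
  logic_iso_bot : f \bot = \bot;
  logic_iso_top : f \top = \top;
  logic_iso_meet : forall x y, f (Order.meet x y) = Order.meet (f x) (f y);
  logic_iso_join : forall x y, f (Order.join x y) = Order.join (f x) (f y);
  logic_iso_bigjoin : forall S, f (bigjoin S) = bigjoin (f @` S);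
  logic_iso_bigmeet : forall S, f (bigmeet S) = bigmeet (f @` S);
  logic_iso_ocompl : forall x, f (ocompl x) = ocompl (f x);
}.

Section CompleteFacts.
Context {d} {E : completeLatticeType d}.
Implicit Types (x y : E) (S : set E).

Lemma bigjoin_ub S x : S x -> x <= bigjoin S.
Proof. by case: (bigjoin_supremum S) => h _; apply: h. Qed.
Lemma bigjoin_le S y : (forall x, S x -> x <= y) -> bigjoin S <= y.
Proof. by case: (bigjoin_supremum S) => _ h yS; apply: h => x; apply: yS. Qed.
Lemma bigmeet_lb S x : S x -> bigmeet S <= x.
Proof. by case: (bigmeet_infimum S) => h _; apply: h. Qed.
Lemma le_bigmeet S y : (forall x, S x -> y <= x) -> y <= bigmeet S.
Proof. by case: (bigmeet_infimum S) => _ h yS; apply: h => x; apply: yS. Qed.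
End CompleteFacts.

(* Every index set of cardinality at most 2^|E| is, up to bijection, a subset
   of the powerset of E. *)
Definition term d (E : logicType d) : Type := {I : set (set E) & I -> E}.
Definition term_family d (E : logicType d) (t : term E) : projT1 t -> E :=
  projT2 t.
Coercion term_family : term >-> Funclass.

Section Terms.
Context {d} {E : logicType d}.

Definition covered (I J : Type) (a : I -> E) (b : J -> E) : Prop :=
  forall i, (exists j, a i <= b j) \/ (~ inhabited J /\ a i = \bot).

Definition fam_equiv (I J : Type) (a : I -> E) (b : J -> E) : Prop :=
  covered a b /\ covered b a.

Definition fam_sum (I J : Type) (a : I -> E) (b : J -> E) (k : I + J) : E :=
  match k with inl i => a i | inr j => b j end.

Lemma covered_refl I (a : I -> E) : covered a a.
Proof. by move=> i; left; exists i. Qed.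

Lemma covered_trans I J K (b : J -> E) (a : I -> E) (c : K -> E) :
  covered a b -> covered b c -> covered a c.
Proof.
move=> ab bc i; case: (ab i) => [[j aibj]|[_ ai0]].
  case: (bc j) => [[k bjck]|[K0 bj0]]; first by left; exists k; exact: le_trans bjck.
  by right; split=> //; apply/eqP; rewrite -lex0 -bj0.
have [[k]|K0] := pselect (inhabited K); last by right.
by left; exists k; rewrite ai0 le0x.
Qed.

Lemma fam_equiv_refl I (a : I -> E) : fam_equiv a a.
Proof. by split; exact: covered_refl. Qed.

Lemma fam_equiv_sym I J (a : I -> E) (b : J -> E) :
  fam_equiv a b -> fam_equiv b a.
Proof. by case. Qed.

Lemma fam_equiv_trans I J K (b : J -> E) (a : I -> E) (c : K -> E) :
  fam_equiv a b -> fam_equiv b c -> fam_equiv a c.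
Proof.
by move=> [ab ba] [bc cb]; split; [exact: covered_trans bc|exact: covered_trans ba].
Qed.

Lemma term_of_family I (a : I -> E) :
  exists2 t : term E, projT1 t !=set0 & fam_equiv t a.
Proof.
have [[i0]|I0] := pselect (inhabited I).
  pose J : set (set E) := range (fun i => [set a i]).
  have Jsel (j : J) : exists i, val j = [set a i].
    by case: (set_valP j) => i _ <-; exists i.
  exists (existT (fun J : set (set E) => J -> E) J
            (fun j => a (projT1 (cid (Jsel j))))).
    by exists [set a i0], i0.
  split=> [j|i]; left; rewrite /term_family /=.
    by exists (projT1 (cid (Jsel j))).
  have Ji : J [set a i] by exists i.
  exists (SigSub (mem_set Ji)); case: cid => k /= aik.
  by have -> : a i = a k by have : [set a k] (a i) by rewrite -aik.
exists (existT (fun J : set (set E) => J -> E) [set set0] (fun=> \bot)).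
  by exists set0.
by split=> [j|i]; [right|case: I0].
Qed.

End Terms.

Definition equiv_class d (E : logicType d) (I : Type) (a : I -> E) :
  set (term E) := [set t : term E | fam_equiv t a].

Definition Dset d (E : logicType d) : set (set (term E)) :=
  range (fun t : term E => equiv_class t).

Definition D d (E : logicType d) : Type := set_type (@Dset d E).
HB.instance Definition _ d (E : logicType d) := Choice.on (D E).

Section DTheory.
Context {d} {E : logicType d}.
Implicit Types (A B C : D E).

Lemma equiv_class_in I (a : I -> E) : equiv_class a \in @Dset d E.
Proof.
have [t _ ta] := term_of_family a; apply: mem_set; exists t => //.
apply/seteqP; split=> s st /=; first exact: fam_equiv_trans st ta.
by apply: fam_equiv_trans st _; exact: fam_equiv_sym.
Qed.

Definition cls (I : Type) (a : I -> E) : D E := SigSub (equiv_class_in a).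
Definition cls1 (x : E) : D E := cls (fun _ : unit => x).

Lemma cls_eqP I J (a : I -> E) (b : J -> E) :
  (cls a = cls b) <-> fam_equiv a b.
Proof.
split=> [/(congr1 val) /= ab|ab]; last first.
  apply: val_inj => /=; apply/seteqP; split=> s sa /=.
    exact: fam_equiv_trans sa ab.
  by apply: fam_equiv_trans sa _; exact: fam_equiv_sym.
have [t _ ta] := term_of_family a.
have : equiv_class a t by [].
by rewrite ab; apply: fam_equiv_trans; exact: fam_equiv_sym.
Qed.

Lemma exists_repr A : exists t : term E, projT1 t !=set0 /\ A = cls t.
Proof.
have [s _ sA] := set_valP A.
have [t t0 ts] := term_of_family s; exists t; split=> //.
transitivity (cls s); first by apply: val_inj; rewrite /= -sA.
by apply/cls_eqP; exact: fam_equiv_sym.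
Qed.

Definition term_repr A : term E := projT1 (cid (exists_repr A)).
Lemma repr_neq0 A : projT1 (term_repr A) !=set0.
Proof. by rewrite /term_repr; case: cid => t []. Qed.
Lemma reprK A : cls (term_repr A) = A.
Proof. by rewrite /term_repr; case: cid => t []. Qed.

Lemma repr_cls I (a : I -> E) : fam_equiv (term_repr (cls a)) a.
Proof. by apply/cls_eqP; rewrite reprK. Qed.

Definition D_le A B : bool := cls (fam_sum (term_repr A) (term_repr B)) == B.

Lemma D_leP I J (a : I -> E) (b : J -> E) :
  D_le (cls a) (cls b) <-> covered a b.
Proof.
have [raa ara] := repr_cls a; have [rbb brb] := repr_cls b.
have [s /mem_set rs] := repr_neq0 (cls b).
split=> [/eqP/esym|ab]; last first.
  have rab := covered_trans raa (covered_trans ab brb).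
  apply/eqP; rewrite -[RHS]reprK; apply/cls_eqP; split.
    by case=> [i|j]; [exact: rab|exact: covered_refl].
  by move=> j; left; exists (inr j).
rewrite -[LHS]reprK => /cls_eqP[_ h].
apply: covered_trans ara _; apply: covered_trans rbb => i.
exact: (h (inl i)).
Qed.

Lemma D_le_refl : reflexive D_le.
Proof. by move=> A; rewrite -(reprK A); apply/D_leP; exact: covered_refl. Qed.

Lemma D_le_anti : antisymmetric D_le.
Proof.
move=> A B; rewrite -(reprK A) -(reprK B) => /andP[/D_leP ab /D_leP ba].
by apply/cls_eqP.
Qed.

Lemma D_le_trans : transitive D_le.
Proof.
move=> B A C; rewrite -(reprK A) -(reprK B) -(reprK C) => /D_leP ab /D_leP bc.
by apply/D_leP; exact: covered_trans bc.
Qed.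

End DTheory.

HB.instance Definition _ d (E : logicType d) :=
  Order.Le_isPOrder.Build d (D E) D_le_refl D_le_anti D_le_trans.

Section DComplete.
Context {d} {E : logicType d}.
Implicit Types (A B C : D E) (S : set (D E)).

Lemma le_clsP I J (a : I -> E) (b : J -> E) :
  (cls a <= cls b) <-> covered a b.
Proof. exact: D_leP. Qed.

(* The order does not depend on the representatives. *)
Lemma le_cls I J (a : I -> E) (b : J -> E) : inhabited I -> inhabited J ->
  (cls a <= cls b) = (cls (fam_sum a b) == cls b).
Proof.
move=> _ [j0]; apply/idP/eqP => [/le_clsP ab|/cls_eqP[h _]].
  apply/cls_eqP; split; last by move=> j; left; exists (inr j).
  by case=> [i|j]; [exact: ab|exact: covered_refl].
by apply/le_clsP => i; exact: (h (inl i)).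
Qed.

Lemma cls_leP I (a : I -> E) B : (cls a <= B) <-> forall i, cls1 (a i) <= B.
Proof.
rewrite -(reprK B); split=> [/le_clsP aB i|aB].
  by apply/le_clsP => -[]; exact: aB.
by apply/le_clsP => i; have /le_clsP/(_ tt) := aB i.
Qed.

(* The disjoint union of representatives of the members of S. *)
Definition D_bigjoin S : D E :=
  cls (fun k : {A : S & projT1 (term_repr (val A))} =>
         term_family (projT2 k)).

Definition D_bigmeet S : D E :=
  cls (fun x : [set x : E | lbound S (cls1 x)] => val x).

Lemma D_bigjoin_supremum S : supremums S (D_bigjoin S).
Proof.
split=> [A SA|B SB].
  rewrite -(reprK A); apply/le_clsP => i; left.
  by exists (existT (fun A : S => projT1 (term_repr (val A)))
               (SigSub (mem_set SA)) i).
apply/cls_leP => -[A i] /=.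
by have /SB := set_valP A; rewrite -{1}(reprK (val A)) => /cls_leP.
Qed.

Lemma D_bigmeet_infimum S : infimums S (D_bigmeet S).
Proof.
split=> [A SA|B SB]; first by apply/cls_leP => x; exact: (set_valP x).
rewrite -(reprK B); apply/le_clsP => i; left.
have lbi : [set x : E | lbound S (cls1 x)] (term_repr B i).
  by move=> A /SB; rewrite -{1}(reprK B) => /cls_leP.
by exists (SigSub (mem_set lbi)).
Qed.

Definition D_meet A B := D_bigmeet [set A; B].
Definition D_join A B := D_bigjoin [set A; B].

Lemma D_lexI A B C : (A <= D_meet B C) = (A <= B) && (A <= C).
Proof.
have [lb glb] := D_bigmeet_infimum [set B; C].
apply/idP/andP => [h|[AB AC]]; last by apply: glb => _ [] ->.
by split; apply: (le_trans h); apply: lb; [left|right].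
Qed.

Lemma D_leUx A B C : (D_join A B <= C) = (A <= C) && (B <= C).
Proof.
have [ub lub] := D_bigjoin_supremum [set A; B].
apply/idP/andP => [h|[AC BC]]; last by apply: lub => _ [] ->.
by split; apply: le_trans h; apply: ub; [left|right].
Qed.

Lemma D_le0x A : cls1 \bot <= A.
Proof.
rewrite -(reprK A); apply/le_clsP => -[]; left.
by have [s /mem_set rs] := repr_neq0 A; exists (SigSub rs); rewrite le0x.
Qed.

Lemma D_lex1 A : A <= cls1 \top.
Proof. by rewrite -(reprK A); apply/le_clsP => i; left; exists tt; rewrite lex1. Qed.

End DComplete.

HB.instance Definition _ d (E : logicType d) :=
  Order.POrder_MeetJoin_isLattice.Build d (D E) D_lexI D_leUx.
HB.instance Definition _ d (E : logicType d) :=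
  Order.hasBottom.Build d (D E) D_le0x.
HB.instance Definition _ d (E : logicType d) :=
  Order.hasTop.Build d (D E) D_lex1.
HB.instance Definition _ d (E : logicType d) :=
  isCompletePOrder.Build d (D E) D_bigjoin_supremum D_bigmeet_infimum.

Section Star.
Context {d} {E : logicType d}.
Implicit Types (A B : D E).

Definition fam_star (I : Type) (a : I -> E) : D E :=
  cls1 (bigmeet (range (fun i => ocompl (a i)))).

Definition star A : D E := fam_star (term_repr A).

Lemma le_cls1 (x y : E) : (cls1 x <= cls1 y) = (x <= y).
Proof.
apply/idP/idP => [/le_clsP/(_ tt)[[]//|[[]]]|xy]; first exact: (inhabits tt).
by apply/le_clsP => -[]; left; exists tt.
Qed.

Lemma ocompl0 : ocompl \bot = \top :> E.
Proof. by rewrite -(joinx_ocompl (\bot : E)) join0x. Qed.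

Lemma ocompl1 : ocompl \top = \bot :> E.
Proof. by rewrite -ocompl0 ocomplK. Qed.

Lemma fam_star_anti I J (a : I -> E) (b : J -> E) :
  covered a b -> fam_star b <= fam_star a.
Proof.
move=> ab; rewrite le_cls1; apply: le_bigmeet => _ [i _ <-].
case: (ab i) => [[j aibj]|[_ ->]]; last by rewrite ocompl0 lex1.
by apply: le_trans _ (ocompl_anti _ _ aibj); apply: bigmeet_lb; exists j.
Qed.

(* Holds in particular for nonempty I; for empty I the meet is \top, in
   agreement with [\bot]. *)
Lemma star_cls I (a : I -> E) : star (cls a) = fam_star a.
Proof.
have [ra ar] := repr_cls a; apply/le_anti.
by rewrite !fam_star_anti.
Qed.

Lemma star_anti A B : A <= B -> star B <= star A.
Proof.
by rewrite -(reprK A) -(reprK B) => /le_clsP ab; rewrite !star_cls fam_star_anti.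
Qed.

Lemma star_cls1 x : star (cls1 x) = cls1 (ocompl x).
Proof.
rewrite star_cls /fam_star; congr cls1; apply/le_anti/andP; split.
  by apply: bigmeet_lb; exists tt.
by apply: le_bigmeet => _ [i _ <-].
Qed.

Lemma starstar_cls1 x : star (star (cls1 x)) = cls1 x.
Proof. by rewrite !star_cls1 ocomplK. Qed.

Lemma star3 A : star (star (star A)) = star A.
Proof. exact: starstar_cls1. Qed.

Lemma le_starstar A : A <= star (star A).
Proof.
rewrite {1}star_cls1 -[A in A <= _]reprK; apply/cls_leP => i.
rewrite le_cls1 -[leLHS]ocomplK; apply: ocompl_anti.
by apply: bigmeet_lb; exists i.
Qed.

Lemma star0 : star \bot = \top. Proof. by rewrite star_cls1 ocompl0. Qed.
Lemma star1 : star \top = \bot. Proof. by rewrite star_cls1 ocompl1. Qed.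

Lemma meet_star A : Order.meet A (star A) = \bot.
Proof.
apply/le_anti; rewrite le0x andbT -[leLHS]reprK; apply/cls_leP => k.
have : cls1 (term_repr (Order.meet A (star A)) k) <= Order.meet A (star A).
  by move: k; apply/cls_leP; rewrite reprK.
move: (term_repr _ k) => x; rewrite lexI => /andP[xA xA'].
rewrite le_cls1 -(meetx_ocompl x) lexI lexx /= -le_cls1.
by apply: le_trans xA' _; rewrite -star_cls1; exact: star_anti.
Qed.

End Star.

Definition U d (E : logicType d) : Type := {A : D E | star (star A) == A}.
HB.instance Definition _ d (E : logicType d) := SubChoice.on (U E).
HB.instance Definition _ d (E : logicType d) :=
  [SubChoice_isSubPOrder of U E by <: with d].

Section UTheory.
Context {d} {E : logicType d}.
Implicit Types (A B C : U E) (S : set (U E)).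

Lemma U_starstar A : star (star (val A)) = val A.
Proof. exact/eqP/(valP A). Qed.

Lemma star_in_U (X : D E) : star (star (star X)) == star X.
Proof. by rewrite star3. Qed.

Lemma cls1_in_U (x : E) : star (star (cls1 x)) == cls1 x.
Proof. by rewrite starstar_cls1. Qed.

Definition U_star (X : D E) : U E :=
  Sub (sT := U E) (star X) (star_in_U X).

Definition phi (x : E) : U E := Sub (sT := U E) (cls1 x) (cls1_in_U x).

Definition U_closure (X : D E) : U E := U_star (star X).

Lemma U_closure_le (X : D E) A : (U_closure X <= A) = (X <= val A).
Proof.
rewrite -Order.le_val /=; apply/idP/idP => [|XA].
  by apply: le_trans; exact: le_starstar.
by rewrite -U_starstar; do 2 apply: star_anti.
Qed.

Lemma bigmeet_in_U S :
  star (star (bigmeet (val @` S))) == bigmeet (val @` S) :> D E.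
Proof.
apply/eqP/le_anti; rewrite le_starstar andbT.
apply: le_bigmeet => _ [A SA <-]; rewrite -(U_starstar A).
by do 2 apply: star_anti; apply: bigmeet_lb; exists A.
Qed.

Lemma meet_in_U A B :
  star (star (Order.meet (val A) (val B))) == Order.meet (val A) (val B).
Proof.
apply/eqP/le_anti; rewrite le_starstar andbT lexI.
by apply/andP; split; rewrite -[leRHS]U_starstar;
  do 2 apply: star_anti; rewrite ?leIl ?leIr.
Qed.

Definition U_bigjoin S : U E := U_closure (bigjoin (val @` S)).
Definition U_bigmeet S : U E :=
  Sub (sT := U E) (bigmeet (val @` S)) (bigmeet_in_U S).
Definition U_join A B : U E := U_closure (Order.join (val A) (val B)).
Definition U_meet A B : U E :=
  Sub (sT := U E) (Order.meet (val A) (val B)) (meet_in_U A B).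
Definition U_ocompl A : U E := U_star (val A).

Lemma U_bigjoin_supremum S : supremums S (U_bigjoin S).
Proof.
split=> [A SA|B SB].
  rewrite -Order.le_val SubK; apply: le_trans _ (le_starstar _).
  by apply: bigjoin_ub; exists A.
by rewrite U_closure_le; apply: bigjoin_le => _ [A SA <-]; rewrite Order.le_val; apply: SB.
Qed.

Lemma U_bigmeet_infimum S : infimums S (U_bigmeet S).
Proof.
split=> [A SA|B SB]; rewrite -Order.le_val SubK.
  by apply: bigmeet_lb; exists A.
by apply: le_bigmeet => _ [A SA <-]; rewrite Order.le_val; apply: SB.
Qed.

Lemma U_lexI A B C : (A <= U_meet B C) = (A <= B) && (A <= C).
Proof. by rewrite -!Order.le_val SubK lexI. Qed.

Lemma U_leUx A B C : (U_join A B <= C) = (A <= C) && (B <= C).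
Proof. by rewrite U_closure_le leUx -!Order.le_val. Qed.

Lemma U_le0x A : phi \bot <= A.
Proof. by rewrite -Order.le_val SubK; exact: D_le0x. Qed.

Lemma U_lex1 A : A <= phi \top.
Proof. by rewrite -Order.le_val SubK; exact: D_lex1. Qed.

End UTheory.

HB.instance Definition _ d (E : logicType d) :=
  Order.POrder_MeetJoin_isLattice.Build d (U E) U_lexI U_leUx.
HB.instance Definition _ d (E : logicType d) :=
  Order.hasBottom.Build d (U E) U_le0x.
HB.instance Definition _ d (E : logicType d) :=
  Order.hasTop.Build d (U E) U_lex1.
HB.instance Definition _ d (E : logicType d) :=
  isCompletePOrder.Build d (U E) U_bigjoin_supremum U_bigmeet_infimum.

Section UOrthocomplement.
Context {d} {E : logicType d}.
Implicit Types A B : U E.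

Lemma U_ocomplK : involutive (@U_ocompl d E).
Proof. by move=> A; apply: val_inj; rewrite !SubK U_starstar. Qed.

Lemma U_ocompl_anti A B : A <= B -> U_ocompl B <= U_ocompl A.
Proof. by rewrite -!Order.le_val !SubK; exact: star_anti. Qed.

Lemma U_meetx_ocompl A : Order.meet A (U_ocompl A) = \bot.
Proof. by apply: val_inj; rewrite !SubK meet_star. Qed.

Lemma U_joinx_ocompl A : Order.join A (U_ocompl A) = \top.
Proof.
apply: val_inj; rewrite !SubK.
have -> : star (Order.join (val A) (star (val A))) = \bot; last exact: star0.
apply/le_anti; rewrite le0x andbT -(meet_star (star (val A))) lexI.
by rewrite !star_anti ?leUl ?leUr.
Qed.

End UOrthocomplement.

HB.instance Definition _ d (E : logicType d) :=
  isOrthocomplemented.Build d (U E) U_ocomplK (@U_ocompl_anti d E)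
    U_meetx_ocompl U_joinx_ocompl.

(* Main.v *)
Require Import Defs.
From mathcomp Require Import all_boot all_order.
From mathcomp Require Import boolp classical_sets.

Import Order.TTheory.
Local Open Scope classical_set_scope.
Local Open Scope order_scope.

(** The map [a |-> [a]] is an order embedding of the logic [E] into [U E], so
    the point is that it is onto. For a single-element index set of choice
    functions, the star of a class is the class of one element of [E], namely
    of the infimum of the complements of the members of the class. An element
    of [U E] is its own double star, hence itself such a class. A surjective
    order embedding is an order isomorphism, and as bounds, binary and
    arbitrary suprema and infima are determined by the order alone, it
    preserves all of them ([order_iso_logic_iso]). The orthocomplement is not
    determined by the order; it is preserved because the star of [[a]] is
    [[a^c]] ([star_cls1]). *)

(** Everything in the structure of a logic but the orthocomplement is
    determined by the order, so an order isomorphism only has to be checked on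
    orthocomplements. *)
Lemma order_iso_logic_iso d d' (L : logicType d) (M : logicType d')
    (f : L -> M) :
  bijective f -> (forall x y, (f x <= f y) = (x <= y)) ->
  (forall x, f (ocompl x) = ocompl (f x)) -> logic_isomorphism f.
Proof.
move=> bij_f le_f ocompl_f; have [g fK gK] := bij_f.
(* The inverse of f is both a right and a left adjoint of f: the first makes f
   preserve suprema, the second makes it preserve infima. *)
have le_fl x y : (f x <= y) = (x <= g y) by rewrite -{1}[y]gK le_f.
have le_fr x y : (y <= f x) = (g y <= x) by rewrite -{1}[y]gK le_f.
split=> // [||x y|x y|S|S].
- by apply/le_anti; rewrite le0x le_fl le0x.
- by apply/le_anti; rewrite lex1 le_fr lex1.
- apply/le_anti; rewrite lexI !le_f leIl leIr /=.
  by rewrite le_fr lexI -!le_fr leIl leIr.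
- apply/le_anti; rewrite leUx !le_f leUl leUr !andbT.
  by rewrite le_fl leUx -!le_fl leUl leUr.
- apply/le_anti/andP; split.
    rewrite le_fl; apply: bigjoin_le => x Sx.
    by rewrite -le_fl; apply: bigjoin_ub; exists x.
  by apply: bigjoin_le => _ [x Sx <-]; rewrite le_f; apply: bigjoin_ub.
- apply/le_anti/andP; split.
    by apply: le_bigmeet => _ [x Sx <-]; rewrite le_f; apply: bigmeet_lb.
  rewrite le_fr; apply: le_bigmeet => x Sx.
  by rewrite -le_fr; apply: bigmeet_lb; exists x.
Qed.

Lemma le_phi d (E : logicType d) (x y : E) : (phi x <= phi y) = (x <= y).
Proof. by rewrite -Order.le_val !SubK le_cls1. Qed.

(** The outer star of [A = A**] is by construction the class of one element. *)
Lemma phi_surj d (E : logicType d) (A : U E) : exists x : E, phi x = A.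
Proof.
have : star (star (val A)) = val A by exact: U_starstar.
rewrite {1}/star /fam_star; set x := bigmeet _ => xA.
by exists x; apply: val_inj.
Qed.

Lemma phi_inj d (E : logicType d) : injective (@phi d E).
Proof.
move=> x y xy; apply/le_anti.
by rewrite -(le_phi _ _ x y) -(le_phi _ _ y x) xy lexx.
Qed.

Lemma phi_bij d (E : logicType d) : bijective (@phi d E).
Proof.
have [g gK] := choice (@phi_surj d E).
by exists g => // x; apply: phi_inj; exact: gK.
Qed.

Theorem theorem21 (d : Order.disp_t) (E : logicType d) :
  logic_isomorphism (@phi d E).
Proof.
apply: order_iso_logic_iso (@phi_bij d E) (@le_phi d E) _ => x.
by apply: val_inj; rewrite !SubK star_cls1.
Qed.
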